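(* Let $(A,\mathfrak m)$ be a nonzero commutative local ring. Every proper finitely generated ideal of $\mathcal T(A)$ has a nonzero annihilator. Consequently, the only semi-regular ideal of $\mathcal T(A)$ is $\mathcal T(A)$ itself, and $\mathcal T(A)$ is a strongly Prüfer ring, and thus a Prüfer ring.
   Context: All rings are commutative with identity. For a nonzero local ring $(A,\mathfrak m)$ (not necessarily Noetherian) with residue field $\kappa=A/\mathfrak m$ and residue map $a\mapsto\bar a$, define the ring, with coordinatewise operations, $$\mathcal T(A)=\{(a,(c_i)_{i\in\mathbb N})\in A\times\kappa^{\mathbb N}: c_i=\bar a\text{ for all but finitely many }i\},\quad \mathbb N=\{1,2,\ldots\}.$$ An ideal is regular if it contains a non-zero-divisor, and semi-regular if it contains a finitely generated sub-ideal whose annihilator is zero. A ring is Prüfer (respectively, strongly Prüfer) if each finitely generated regular (respectively, semi-regular) ideal is projective. *)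

(* Defs.v *)
From HB Require Import structures.
From mathcomp Require Import all_boot all_algebra ring_quotient.
From mathcomp Require Import boolp classical_sets functions cardinality.

Set Implicit Arguments.
Unset Strict Implicit.
Unset Printing Implicit Defensive.

Import GRing.Theory.
Local Open Scope ring_scope.
Local Open Scope quotient_scope.
Local Open Scope classical_set_scope.

Section Ideals.
Variable R : comPzRingType.

(* Possibly improper ideals: the R-submodules of R. (MathComp's [idealr] only
   covers proper ideals.) *)
Definition ideal : Type := submodClosed R^o.

Definition is_proper (I : ideal) : Prop := ~ (forall x : R, x \in I).

Definition generated_by (s : seq R) : set R :=
  [set x | exists c : 'I_(size s) -> R, x = \sum_(i < size s) c i * s`_i].

Definition finitely_generated (I : ideal) : Prop :=
  exists s : seq R, [set x : R | x \in I] = generated_by s.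

Definition annihilator (I : ideal) : set R :=
  [set r | forall x : R, x \in I -> r * x = 0].

Definition non_zero_divisor (x : R) : Prop := forall y : R, x * y = 0 -> y = 0.

Definition regular_ideal (I : ideal) : Prop :=
  exists2 x : R, x \in I & non_zero_divisor x.

Definition semi_regular_ideal (I : ideal) : Prop :=
  exists J : ideal, [/\ {subset J <= I}, finitely_generated J
                      & annihilator J = [set 0]].

Record ideal_module (I : ideal) : Type :=
  IdealElt { ideal_val : R^o; _ : ideal_val \in I }.

HB.instance Definition _ (I : ideal) := [isSub for @ideal_val I].
HB.instance Definition _ (I : ideal) := [Choice of ideal_module I by <:].
HB.instance Definition _ (I : ideal) :=
  [SubChoice_isSubLmodule of ideal_module I by <:].

Definition projective (P : lmodType R) : Prop :=
  forall (M N : lmodType R) (g : {linear M -> N}) (f : {linear P -> N}),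
    (forall y : N, exists x : M, g x = y) ->
    exists h : {linear P -> M}, forall p : P, g (h p) = f p.

Definition prufer : Prop :=
  forall I : ideal, finitely_generated I -> regular_ideal I ->
    projective (ideal_module I).

Definition strongly_prufer : Prop :=
  forall I : ideal, finitely_generated I -> semi_regular_ideal I ->
    projective (ideal_module I).

End Ideals.

Section LocalRing.
Variable A : comNzRingType.

(* Elements of [idealr A] are proper by definition. *)
Definition maximal_ideal (m : idealr A) : Prop :=
  forall J : idealr A, {subset m <= J} -> J =i m.

Definition local_ring (m : idealr A) : Prop :=
  maximal_ideal m /\ forall J : idealr A, maximal_ideal J -> J =i m.

End LocalRing.

Section TRing.
Variables (A : comNzRingType) (m : idealr A).

Definition residue (a : A) : {ideal_quot m} := \pi_{ideal_quot m} a.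

(* The coordinates are indexed from 0 instead of 1. *)
Definition T_pred : {pred A * (nat -> {ideal_quot m})} :=
  fun p => `[< finite_set [set i | p.2 i <> residue p.1] >].

Lemma T_subring_closed : subring_closed T_pred.
Proof.
split=> [|p q|p q]; rewrite ?unfold_in.
- apply/asboolP; rewrite (_ : [set i | _] = set0) ?finite_set0//.
  by apply/seteqP; split=> i //=; rewrite /residue rmorph1.
- move=> /asboolP fp /asboolP fq; apply/asboolP.
  apply: (@sub_finite_set _ _ ([set i | p.2 i <> residue p.1]
    `|` [set i | q.2 i <> residue q.1])); last by rewrite finite_setU.
  move=> i /= H; apply: contrapT => /not_orP[/contrapT pi /contrapT qi].
  by apply: H; rewrite /residue rmorphB /= -/(residue _) -/(residue _) -pi -qi.
- move=> /asboolP fp /asboolP fq; apply/asboolP.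
  apply: (@sub_finite_set _ _ ([set i | p.2 i <> residue p.1]
    `|` [set i | q.2 i <> residue q.1])); last by rewrite finite_setU.
  move=> i /= H; apply: contrapT => /not_orP[/contrapT pi /contrapT qi].
  by apply: H; rewrite /residue rmorphM /= -/(residue _) -/(residue _) -pi -qi.
Qed.

HB.instance Definition _ :=
  GRing.isSubringClosed.Build _ T_pred T_subring_closed.

(* With the ring structure inherited from the product ring, i.e. with
   coordinatewise operations. *)
Record T_ring : Type :=
  TElt { T_val : A * (nat -> {ideal_quot m}); _ : T_val \in T_pred }.

HB.instance Definition _ := [isSub for T_val].
HB.instance Definition _ := [Choice of T_ring by <:].
HB.instance Definition _ := [SubChoice_isSubComNzRing of T_ring by <:].

End TRing.

(* Main.v *)
Require Import Defs.
From mathcomp Require Import all_boot all_algebra ring_quotient.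
From mathcomp Require Import boolp classical_sets functions cardinality.
From HB Require Import structures.
Import GRing.Theory.
Local Open Scope ring_scope.
Local Open Scope classical_set_scope.

(** Let [x_1, ..., x_n] generate an ideal [I] of [T(A)]. If some coordinate
[i] vanishes on all the [x_k], the idempotent supported at [i] annihilates
[I]. This happens when all first components lie in [m], since then almost all
the coordinates of each [x_k] vanish. Otherwise some [x_k] has a first
component invertible in [A]; multiplying by a constant lift of its inverse
gives an element of [I] that agrees with [1] except at finitely many
coordinates, and at each of these the idempotent belongs to [I] because some
[x_l] has a nonzero, hence invertible, entry there. So [1] is in [I]. *)

(** * Maximal ideals and units of a local ring *)

Section LocalUnits.
Set Implicit Arguments.
Unset Strict Implicit.
Variable A : comNzRingType.

(** Proper ideals as bare sets, the form in which Zorn's lemma for unions of chains applies. *)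
Definition proper_ideal_set (X : set A) : Prop :=
  [/\ X 0, ~ X 1 & forall c x y, X x -> X y -> X (c * x + y)].

Lemma idealr_of_set (X : set A) : proper_ideal_set X ->
  exists J : idealr A, forall x, (x \in J) = `[< X x >].
Proof.
move=> [X0 X1 XM].
have cl : idealr_closed (fun x => `[< X x >]).
  split=> [||c x y]; rewrite ?unfold_in.
  - exact/asboolP.
  - exact/asboolPn.
  - by move=> /asboolP Xx /asboolP Xy; apply/asboolP; apply: XM.
pose J : idealr A := HB.pack (fun x => `[< X x >]) (isIdealr.Build A _ cl).
by exists J.
Qed.

Lemma idealr_proper_ideal_set (J : idealr A) :
  proper_ideal_set [set x : A | x \in J].
Proof.
split=> [||c x y] /=; [exact: rpred0|by rewrite idealr1|].
by move=> xJ yJ; rewrite rpredD // idealMr.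
Qed.

(** Zorn's lemma for the proper ideals containing [a]. *)
Lemma nonunit_in_maximal_ideal (a : A) : (forall b, b * a <> 1) ->
  exists2 J : idealr A, maximal_ideal J & a \in J.
Proof.
move=> aN1.
(* [set0] accounts for the union of the empty chain. *)
pose P (X : set A) := X = set0 \/ (X a /\ proper_ideal_set X).
have [F FP Ftot|X [PX Xmax]] := @Zorn_bigcup A P.
  have [[X FX [Xa XI]]|FN] :=
      pselect (exists2 X, F X & X a /\ proper_ideal_set X); last first.
    left; apply/seteqP; split=> // x [X FX Xx].
    have [X0|XI] := FP _ FX; first by rewrite X0 in Xx.
    by case: FN; exists X.
  right; split; first by exists X.
  split.
  - by exists X => //; case: XI.
  - move=> [Y FY Y1]; have [Y0|[_ [_ YN1 _]]] := FP _ FY; last exact: YN1.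
    by rewrite Y0 in Y1.
  - move=> c x y [Y FY Yx] [Z FZ Zy].
    have closed W : F W -> W x -> W y -> W (c * x + y).
      move=> FW Wx Wy; have [W0|[_ [_ _ WM]]] := FP _ FW; last exact: WM.
      by rewrite W0 in Wx.
    have [YZ|ZY] := Ftot _ _ FY FZ.
      by exists Z => //; apply: closed => //; apply: YZ.
    by exists Y => //; apply: closed => //; apply: ZY.
have [X0|[Xa XI]] := PX.
  (* The empty set is not maximal: the multiples of [a] form a larger set satisfying [P], proper
     because [a] is not a unit. *)
  case: (Xmax [set x | exists b, x = b * a]).
    rewrite X0; split=> // /(_ a); apply; exists 1; by rewrite mul1r.
  right; split; first by exists 1; rewrite mul1r.
  split; first by exists 0; rewrite mul0r.
    by move=> [b /esym]; apply: aN1.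
  by move=> c _ _ [u ->] [v ->]; exists (c * u + v); rewrite mulrDl mulrA.
have [J JE] := idealr_of_set XI; exists J; last by rewrite JE; apply/asboolP.
move=> K JK x; apply/idP/idP; last exact: JK.
apply: contraTT => xJ; apply/negP => xK.
have XK : X `<=` [set x | x \in K].
  by move=> y Xy; apply: JK; rewrite JE; apply/asboolP.
apply: (Xmax [set x | x \in K]); last first.
  by right; split; [apply: XK|apply: idealr_proper_ideal_set].
by split=> // /(_ x xK) Xx; move: xJ; rewrite JE; move/asboolPn; apply.
Qed.

(** A non-unit lies in some maximal ideal, and [m] is the only one. *)
Lemma local_ring_unit (m : idealr A) (a : A) :
  local_ring m -> a \notin m -> exists b, b * a = 1.
Proof.
move=> [_ mE] am; apply: contrapT => /forallNP /nonunit_in_maximal_ideal.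
by move=> [J /mE JE aJ]; rewrite -JE aJ in am.
Qed.

End LocalUnits.

(** * Coordinates and elements of finite support *)

Section Coordinates.
Set Implicit Arguments.
Unset Strict Implicit.
Variables (A : comNzRingType) (m : idealr A).
Local Notation T := (T_ring m).
Local Notation kappa := {ideal_quot m}.

Lemma residue_eq0 (a : A) : (residue m a == 0) = (a \in m).
Proof.
rewrite -[a in RHS]subr0 Quotient.idealrBE /residue.
by rewrite -[X in _ == X](rmorph0 (\pi_kappa)%qT).
Qed.

(** A representative of a nonzero class lies outside [m], so it is a unit of [A]. *)
Lemma residue_field (c : kappa) : local_ring m -> c != 0 -> exists d, d * c = 1.
Proof.
move=> hA; rewrite -[c]reprK -/(residue m (repr c)) residue_eq0.
move=> /(local_ring_unit hA) [b ba1].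
by exists (residue m b); rewrite /residue -rmorphM ba1 rmorph1.
Qed.

Definition base (x : T) : A := (T_val x).1.
Definition coord (i : nat) (x : T) : kappa := (T_val x).2 i.

Lemma T_ext (x y : T) :
  base x = base y -> (forall i, coord i x = coord i y) -> x = y.
Proof.
rewrite /base /coord => xy1 xy2; apply: val_inj => /=.
by case: (T_val x) (T_val y) xy1 xy2 => [a c] [b d] /= -> /funext ->.
Qed.

Lemma baseB (x y : T) : base (x - y) = base x - base y.
Proof. by []. Qed.

Lemma baseM (x y : T) : base (x * y) = base x * base y.
Proof. by []. Qed.

Lemma coordB i (x y : T) : coord i (x - y) = coord i x - coord i y.
Proof. by []. Qed.

Lemma coordM i (x y : T) : coord i (x * y) = coord i x * coord i y.
Proof. by []. Qed.

Lemma base_sum n (F : 'I_n -> T) :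
  base (\sum_(i < n) F i) = \sum_(i < n) base (F i).
Proof. exact: (big_morph base (id1 := 0) (op1 := +%R)). Qed.

Lemma coord_sum n (F : 'I_n -> T) k :
  coord k (\sum_(i < n) F i) = \sum_(i < n) coord k (F i).
Proof. exact: (big_morph (coord k) (id1 := 0) (op1 := +%R)). Qed.

(** Cofiniteness becomes a threshold, so that several conditions combine by taking a maximum. *)
Lemma coord_eventually (x : T) :
  exists N, forall i, (N <= i)%N -> coord i x = residue m (base x).
Proof.
have [s sE] : exists s : seq nat,
    [set i | coord i x <> residue m (base x)] = [set` s].
  by apply/finite_seqP; have := valP x; rewrite unfold_in => /asboolP.
exists (\max_(i <- s) i).+1 => i; apply: contraPP => xi; apply/negP.
rewrite -ltnNge ltnS; apply: (@leq_bigmax_seq _ s xpredT id) => //.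
by have : [set` s] i by rewrite -sE.
Qed.

Lemma T_of_cofinite (a : A) (c : nat -> kappa) (N : nat) :
  (forall i, (N <= i)%N -> c i = residue m a) ->
  exists2 x : T, base x = a & forall i, coord i x = c i.
Proof.
move=> cN; have ac : (a, c) \in T_pred (m := m).
  rewrite unfold_in; apply/asboolP/(sub_finite_set _ (finite_II N)) => i /= ci.
  by rewrite ltnNge; apply/negP => /cN.
by exists (TElt ac).
Qed.

Lemma delta_exists (i : nat) (c : kappa) :
  exists x : T, base x = 0 /\
    forall j, coord j x = if j == i then c else 0.
Proof.
have [|x x1 xj] := @T_of_cofinite 0 (fun j => if j == i then c else 0) i.+1.
  move=> j; case: eqP => [->|_ _]; first by rewrite ltnn.
  by apply/esym/eqP; rewrite residue_eq0 rpred0.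
by exists x.
Qed.

(** For [c = 1] this is the idempotent supported at [i]. *)
Definition delta (i : nat) (c : kappa) : T := projT1 (cid (delta_exists i c)).

Lemma base_delta i c : base (delta i c) = 0.
Proof. by rewrite /delta; case: cid => x []. Qed.

Lemma coord_delta j i c : coord j (delta i c) = if j == i then c else 0.
Proof. by rewrite /delta; case: cid => x []. Qed.

Lemma delta_coordM i (x : T) (c : kappa) :
  delta i c * x = delta i (c * coord i x).
Proof.
apply: T_ext => [|j]; first by rewrite baseM !base_delta mul0r.
by rewrite coordM !coord_delta; case: eqP => [->|_]; rewrite ?mul0r.
Qed.

(** Serves to place [x] in any ideal that contains every [delta i c]. *)
Lemma sum_delta (x : T) (N : nat) :
  base x = 0 -> (forall i, (N <= i)%N -> coord i x = 0) ->
  x = \sum_(i < N) delta i (coord i x).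
Proof.
move=> x0 xN; apply: T_ext => [|j].
  by rewrite base_sum big1 // => i _; rewrite base_delta.
rewrite coord_sum; have [jN|Nj] := ltnP j N; last first.
  rewrite xN // big1 // => i _; rewrite coord_delta; case: eqP => // ji.
  by rewrite -ji xN.
rewrite (bigD1 (Ordinal jN)) //= coord_delta eqxx big1 ?addr0 // => i ij.
rewrite coord_delta; case: eqP => // ji; case/eqP: ij; exact: val_inj.
Qed.

End Coordinates.

(** * Ideals of an arbitrary commutative ring *)

Section Ideals.
Set Implicit Arguments.
Unset Strict Implicit.
Variable R : comPzRingType.
Implicit Type I : ideal R.

Lemma idealM I (c x : R) : x \in I -> c * x \in I.
Proof. exact: (@rpredZ R R^o I c x). Qed.

Lemma ideal_full I : 1 \in I -> forall x : R, x \in I.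
Proof. by move=> I1 x; rewrite -[x]mulr1 idealM. Qed.

Lemma generated_by_mem (s : seq R) x : x \in s -> generated_by s x.
Proof.
move=> /(nthP 0) [k ks <-]; exists (fun i => (i == Ordinal ks)%:R).
rewrite (bigD1 (Ordinal ks)) //= eqxx mul1r big1 ?addr0 // => i /negPf ->.
by rewrite mul0r.
Qed.

Lemma full_semi_regular I : (forall x : R, x \in I) -> semi_regular_ideal I.
Proof.
move=> If; exists I; split=> //.
  exists [:: 1]; apply/seteqP; split=> x _ //=.
  by exists (fun=> x); rewrite big_ord_recl big_ord0 /= mulr1 addr0.
apply/seteqP; split=> [r /(_ _ (If 1))|r -> x _] /=.
  by rewrite mulr1.
by rewrite mul0r.
Qed.

(** Whatever annihilates [I] kills its non-zero-divisor, so [I] is its own witness. *)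
Lemma regular_semi_regular I :
  finitely_generated I -> regular_ideal I -> semi_regular_ideal I.
Proof.
move=> If [x xI xreg]; exists I; split=> //.
apply/seteqP; split=> [r /(_ _ xI) rx|r -> y _] /=.
  by apply: xreg; rewrite mulrC.
by rewrite mul0r.
Qed.

(** The module is free on [1], so a preimage of [f 1] determines a lift. *)
Lemma full_projective I : (forall x : R, x \in I) -> projective (ideal_module I).
Proof.
move=> If M N g f g_surj.
have [x gx] := g_surj (f (IdealElt (If 1))).
pose h (p : ideal_module I) : M := ideal_val p *: x.
have h_lin : linear h.
  by move=> a p q; rewrite /h /= scalerDl scalerA.
pose hL : {linear ideal_module I -> M} :=
  HB.pack h (GRing.isLinear.Build R (ideal_module I) M *:%R h h_lin).
exists hL => p /=.
rewrite /h linearZ /= gx -linearZ; congr (f _); apply: val_inj => /=.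
by rewrite /GRing.scale /= mulr1.
Qed.

End Ideals.

(** * Finitely generated ideals and their annihilators *)

Section Annihilators.
Set Implicit Arguments.
Unset Strict Implicit.
Variables (A : comNzRingType) (m : idealr A).
Hypothesis hA : local_ring m.
Local Notation T := (T_ring m).
Implicit Types (I : ideal T) (s : seq T).

Lemma common_zero_coord s :
  (forall x, x \in s -> base x \in m) ->
  exists i, forall x, x \in s -> coord i x = 0.
Proof.
(* A common threshold, unlike a single index, survives the induction on [s]. *)
move=> sm; suff [N sN] : exists N, forall i, (N <= i)%N ->
    forall x, x \in s -> coord i x = 0 by exists N; exact: sN.
elim: s sm => [|x s IHs] sm; first by exists 0%N.
have [y ys|N1 sN] := IHs; first by apply: sm; rewrite inE ys orbT.
have [N2 xN] := coord_eventually x; exists (maxn N1 N2) => i.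
rewrite geq_max => /andP [N1i N2i] y; rewrite inE => /predU1P [->|ys].
  by rewrite xN //; apply/eqP; rewrite residue_eq0 sm ?mem_head.
exact: sN.
Qed.

Lemma mem1_of_unit_base I x : x \in I -> base x \notin m ->
  (forall i, exists2 y, y \in I & coord i y != 0) -> 1 \in I.
Proof.
move=> xI xm Icoord.
have deltaI i c : delta i c \in I.
  (* Dividing by the coordinate of [y] gives [delta i c = delta i (c * d) * y]. *)
  have [y yI /(residue_field hA) [d dy]] := Icoord i.
  by rewrite -[c]mulr1 -dy mulrA -delta_coordM idealM.
have [b ba1] := local_ring_unit hA xm.
have [|y y1 yi] := @T_of_cofinite _ m b (fun=> residue m b) 0%N; first by [].
have [N xN] := coord_eventually x.
(* Split [1] as [(1 - y * x) + y * x]; the first summand has base zero and vanishes from [N] on. *)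
rewrite -[1](subrK (y * x)) rpredD ?idealM //.
rewrite (@sum_delta _ _ (1 - y * x) N) ?rpred_sum //.
  by rewrite baseB baseM y1 ba1 subrr.
move=> i /xN xi; rewrite coordB coordM yi xi /residue -rmorphM ba1 rmorph1.
exact: subrr.
Qed.

Lemma proper_common_zero_coord I : finitely_generated I -> is_proper I ->
  exists i, forall x, x \in I -> coord i x = 0.
Proof.
move=> [s Is] Iproper; apply: contrapT => /forallNP noi.
have sI x : x \in s -> x \in I.
  by move=> /generated_by_mem; rewrite -Is.
(* A coordinate that vanishes on the generators would vanish on all of [I]. *)
have nzs i : exists2 y, y \in s & coord i y != 0.
  apply: contrapT => nos; apply: (noi i) => x xI.
  have : generated_by s x by rewrite -Is.
  move=> [c ->]; rewrite coord_sum big1 // => k _; rewrite coordM.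
  have [->|sk] := eqVneq (coord i s`_k) 0; first by rewrite mulr0.
  by case: nos; exists s`_k => //; rewrite mem_nth.
have [[x xs xm]|sm] := pselect (exists2 x, x \in s & base x \notin m).
  apply/Iproper/ideal_full/(mem1_of_unit_base (sI _ xs) xm) => i.
  by have [y ys yi] := nzs i; exists y => //; exact: sI.
have [x xs|i si] := @common_zero_coord s.
  by apply: contrapT => /negP xm; apply: sm; exists x.
by have [y /si -> /eqP] := nzs i.
Qed.

Lemma proper_annihilator I : finitely_generated I -> is_proper I ->
  annihilator I <> [set 0].
Proof.
move=> If Iproper; have [i Ii] := proper_common_zero_coord If Iproper.
move=> annI; have : annihilator I (delta i 1).
  move=> x /Ii xi; rewrite delta_coordM xi mulr0.
  apply: T_ext => [|j]; first by rewrite base_delta.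
  by rewrite coord_delta if_same.
rewrite annI => /= /(congr1 (coord i)).
by rewrite coord_delta eqxx; apply/eqP; exact: (oner_neq0 {ideal_quot m}).
Qed.

(** The finitely generated subideal with zero annihilator cannot be proper. *)
Lemma semi_regular_full I : semi_regular_ideal I -> forall x, x \in I.
Proof.
move=> [J [JI Jf annJ]] x; apply/JI; apply: contrapT => xJ.
exact: (proper_annihilator Jf (fun Jall => xJ (Jall x)) annJ).
Qed.

End Annihilators.

Theorem theorem8p1 (A : comNzRingType) (m : idealr A) (hA : local_ring m) :
  [/\ forall I : ideal (T_ring m), finitely_generated I -> is_proper I ->
        annihilator I <> [set 0],
      forall I : ideal (T_ring m),
        semi_regular_ideal I <-> (forall x : T_ring m, x \in I),
      strongly_prufer (T_ring m)
    & prufer (T_ring m)].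
Proof.
have strong : strongly_prufer (T_ring m).
  by move=> I _ /(semi_regular_full hA); exact: full_projective.
split=> [I|I||I If Ireg] //.
- exact: proper_annihilator.
- by split; [exact: semi_regular_full|exact: full_semi_regular].
- exact/strong/regular_semi_regular.
Qed.
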